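(* Consider the model described in the context with parameters $\sigma>1$, $\alpha>-1$, $\beta<0$, $\delta>0$, $L>0$. Assume: (i) there are constants with $0<\bar b_{\min}\le \bar b(x)\le \bar b_{\max}$ for all $x\in\mathcal X$, $0<\bar A_{\min}\le \bar A_i\le \bar A_{\max}$ for all $i$, $T_{ij}=T_{ji}$ and $1\le T_{ij}\le T_{\max}$ for all $i,j$; (ii) $D(x,y_i)=e^{\delta d_i(x)}$ for all $x\in\mathcal X$, $y_i\in\mathcal Y$; (iii) the system $\{d_i\}$ is admissible; $d_i(x)\le d_i(y_j)+d_j(x)$ for all $y_i,y_j\in\mathcal Y$, $x\in\mathcal X$; and there is $r>0$ such that for each $y_i\in\mathcal Y$ one has $c\|x-y_i\|\le d_i(x)\le C\|x-y_i\|$ for all $x\in B_r(y_i)$, with constants $c,C>0$ possibly depending on $r$. Let $\mathcal Y^*\subseteq\mathcal Y$ and let $\lambda=\{\lambda_i\}_{y_i\in\mathcal Y^*}$ be the vector of weights at a $\mathcal Y^*$-centric equilibrium. Let $\gamma_2=1+\sigma\alpha+(\sigma-1)\beta$, $\tilde\sigma=\frac{\sigma-1}{2\sigma-1}$, $\phi_2=-\frac{1+\sigma\alpha}{\beta}$. Then: (a) if $\alpha>1/(\sigma-1)$, a $\mathcal Y^*$-centric equilibrium is always a spatial equilibrium; (b) if $\alpha<1/(\sigma-1)$, no $\mathcal Y^*$-centric equilibrium is a spatial equilibrium, unless $\mathcal Y^*=\mathcal Y$; (c) if $\alpha=1/(\sigma-1)$, a $\mathcal Y^*$-centric equilibrium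 is a spatial equilibrium if and only if $$\tilde\sigma(\sigma-1)\log\frac{\bar A_p}{\bar A_i}+\log\frac{\sum_{j=1}^{n^*}T_{pj}^{1-\sigma}\bar A_j^{\tilde\sigma\sigma}B_j(\lambda)^{\tilde\sigma\phi_2}e^{-\frac{\delta}{\beta}\tilde\sigma\gamma_2\lambda_j}}{\sum_{j=1}^{n^*}T_{ij}^{1-\sigma}\bar A_j^{\tilde\sigma\sigma}B_j(\lambda)^{\tilde\sigma\phi_2}e^{-\frac{\delta}{\beta}\tilde\sigma\gamma_2\lambda_j}}+\tilde\sigma\sigma\delta\, d_i(y_p)<0$$ for all $y_p\in\mathcal Y\setminus\mathcal Y^*$, with $y_i\in\mathcal Y^*$ such that $y_p\in\Omega_i(\lambda)$.
   Context: Setting. $\mathcal X\subset\mathbb R^2$ is open, bounded and connected; $\mathcal Y=\{y_1,\dots,y_n\}\subset\mathcal X$ is a finite set of $n\ge2$ points (''business districts''). Data: $\bar b:\mathcal X\to\mathbb R_+$ (exogenous amenities), numbers $\bar A_i\in\mathbb R_+$ (exogenous productivities), trade costs $T_{ij}=T(y_i,y_j)\in[1,\infty)$, continuous ''distance'' functions $d_i:\mathbb R^2\to\mathbb R_+$ (one for each $y_i$), and commuting costs $D(x,y_i)\in[1,\infty)$. $B_r(y_i)$ is the Euclidean ball and $|\cdot|$ of a planar set is Lebesgue measure. Admissible system. $\{d_i\}$ is admissible if for all $y_i\ne y_j$ and every bounded open $C\subset\mathbb R^2$ there are constants $m_{ij}<M_{ij}$ such that, with $R_c(y_i,y_j)=\{x\in\mathbb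 R^2: d_i(x)-d_j(x)<c\}$, the map $c\mapsto |C\cap R_c(y_i,y_j)|$ increases continuously from $0$ to $|C|$ as $c$ grows from $m_{ij}$ to $M_{ij}$, $C\cap R_c(y_i,y_j)=\emptyset$ for $c\le m_{ij}$, and $C\subset R_c(y_i,y_j)$ for $c\ge M_{ij}$. $\mathcal Y^*$-centric equilibrium. For nonempty $\mathcal Y^*\subseteq\mathcal Y$, order $\mathcal Y$ so that $\mathcal Y^*=\{y_1,\dots,y_{n^*}\}$. A $\mathcal Y^*$-centric equilibrium consists of wages $w_i>0$ $(i\le n^* )$, a density $\ell:\mathcal X\to(0,\infty)$ of residents, commuting areas $\Omega_i\subseteq\mathcal X$ $(i\le n^* )$ with $|\Omega_i|>0$ (all districts in $\mathcal Y^*$ are active), and a welfare level $V>0$ such that: 1. $L_i=\int_{\Omega_i}\ell(x)\,dx$, $A_i=\bar A_iL_i^{\alpha}$, $b(x)=\bar b(x)\ell(x)^{\beta}$. 2. $p_i=w_i/A_i$, $p^i_j=T_{ij}p_i$ (price at $y_j$ of the variety made at $y_i$), $P_i=\big(\sum_{j=1}^{n^*}(p^j_i)^{1-\sigma}\big)^{1/(1-\sigma)}$. 3. $A_iL_i=\sum_{j=1}^{n^*}T_{ij}C^i_jL_j$ for all $i\le n^*$, with $C^i_j=(p^i_j)^{-\sigma}P_j^{\sigma-1}w_j$. 4. With $V(x,y_i)=\dfrac{b(x)w_i}{D(x,y_i)P_i}$, one has $\Omega_i=\{x\in\mathcal X: V(x,y_i)>V(x,y_j)\ \forall j\le n^*,\,j\ne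 i\}$, and $V(x,y_i)=V$ for all $x\in\Omega_i$, $i\le n^*$, where $V=\max_{x\in\mathcal X,\,y_i\in\mathcal Y^*}V(x,y_i)$. 5. $\sum_{i=1}^{n^*}\int_{\Omega_i}\ell(x)\,dx=L$. Its vector of weights is $\lambda_i=\frac1\delta\log\frac{w_i}{P_i}$, $i\le n^*$; then $\Omega_i=\Omega_i(\lambda)=\{x\in\mathcal X: d_i(x)-\lambda_i<\min_{j\ne i,\,j\le n^*}(d_j(x)-\lambda_j)\}$. Further, $B_i(\lambda)=\Big[\int_{\Omega_i(\lambda)}\big(\bar b(x)/D(x,y_i)\big)^{-1/\beta}dx\Big]^{-\beta}$. Potential weight at a vacant district $y_p\in\mathcal Y\setminus\mathcal Y^*$. Let $y_i\in\mathcal Y^*$ be such that $y_p\in\Omega_i(\lambda)$. For small $L_p>0$ put $L_i^-=L_i-L_p$, $L_j^-=L_j$ for $j\neq i$, and $P_p=\big(\sum_{j=1}^{n^*}(T_{jp}p_j)^{1-\sigma}\big)^{1/(1-\sigma)}$, all quantities of $\mathcal Y^*$ being kept at their equilibrium values. Let $w_p=w_p(L_p)>0$ be the unique positive solution of $$w_p^{\sigma}L_p^{1-\alpha(\sigma-1)}=\sum_{j=1}^{n^*}T_{pj}^{1-\sigma}\bar A_p^{\sigma-1}P_j^{\sigma-1}w_jL_j^-+\bar A_p^{\sigma-1}P_p^{\sigma-1}w_pL_p .$$ The potential weight is $\lambda_p=\lim_{L_p\to0^+}\frac1\delta\log\frac{w_p(L_p)}{P_p}\in[-\infty,+\infty]$.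 Spatial equilibrium. A $\mathcal Y^*$-centric equilibrium is a spatial equilibrium if it is sustainable against deviations to vacant districts (agents being allowed to choose any commuting destination in $\mathcal Y$), meaning: for every $y_p\in\mathcal Y\setminus\mathcal Y^*$, $\lambda_p<\lambda_i-d_i(y_p)$, where $y_i\in\mathcal Y^*$ is such that $y_p\in\Omega_i(\lambda)$.
   Formalization: In (b) it is assumed explicitly that every vacant district lies in some commuting area Ω_i(λ); a vacant district on a boundary between areas has no defined potential weight, and in (a) and (c) the condition is only imposed on vacant districts lying in some Ω_i(λ). *)

(* Defs.v *)
From HB Require Import structures.
From mathcomp Require Import all_boot all_order all_algebra.
From mathcomp Require Import all_classical all_reals all_analysis.

Set Implicit Arguments.
Unset Strict Implicit.
Unset Printing Implicit Defensive.

Import Order.TTheory GRing.Theory Num.Theory.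
Import numFieldNormedType.Exports.

Local Open Scope classical_set_scope.
Local Open Scope ring_scope.

(* Districts are indexed by 'I_n.  A set of active districts is a
   S : {set 'I_n}; quantities attached to active districts are total functions
   on 'I_n of which only the values on S are ever constrained or used. *)

Section Plane.
Context {R : realType}.

Definition area : set (R * R) -> \bar R :=
  (@lebesgue_measure R \x @lebesgue_measure R)%E.

(* The library norm on R * R is the max norm (same topology and same bounded
   sets), so the Euclidean distance has to be written out. *)
Definition euclid (x y : R * R) : R :=
  Num.sqrt ((x.1 - y.1) ^+ 2 + (x.2 - y.2) ^+ 2).

End Plane.

Record economy (R : realType) (n : nat) := Economy {
  city : set (R * R);
  site : 'I_n -> R * R;
  bbar : R * R -> R;
  Abar : 'I_n -> R;
  trade : 'I_n -> 'I_n -> R;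
  dist : 'I_n -> R * R -> R;
  commuting : R * R -> 'I_n -> R;
  city_open : open city;
  city_bounded : bounded_set city;
  city_connected : connected city;
  site_inj : injective site;
  site_city : forall i, city (site i);
  bbar_ge0 : forall x, city x -> 0 <= bbar x;
  Abar_ge0 : forall i, 0 <= Abar i;
  trade_ge1 : forall i j, 1 <= trade i j;
  dist_continuous : forall i, continuous (dist i);
  dist_ge0 : forall i x, 0 <= dist i x;
  commuting_ge1 : forall x i, city x -> 1 <= commuting x i
}.

Section Admissible.
Context {R : realType} {n : nat}.
Implicit Type d : 'I_n -> R * R -> R.

Definition Rc d (i j : 'I_n) (c : R) : set (R * R) :=
  [set x | d i x - d j x < c].

(* "Increases" is meant in the wide sense: a strict reading fails for every
   system, e.g. when C is empty. *)
Definition admissible d : Prop :=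
  forall i j : 'I_n, i != j ->
  forall C : set (R * R), open C -> bounded_set C ->
  exists m M : R,
    [/\ m < M,
        {within `[m, M], continuous (fun c => area (C `&` Rc d i j c))},
        {in `[m, M] &, {homo (fun c => area (C `&` Rc d i j c)) :
                          c c' / c <= c' >-> (c <= c')%E}},
        area (C `&` Rc d i j m) = 0%E /\ area (C `&` Rc d i j M) = area C &
        (forall c, c <= m -> C `&` Rc d i j c = set0) /\
        (forall c, M <= c -> C `<=` Rc d i j c)].

End Admissible.

Record allocation (R : realType) (n : nat) := Allocation {
  wage : 'I_n -> R;
  density : R * R -> R;
  zone : 'I_n -> set (R * R);
  welfare : R
}.

Section Equilibrium.
Context {R : realType} {n : nat}.
Variables (E : economy R n) (sigma alpha beta delta : R).
Variables (S : {set 'I_n}) (e : allocation R n).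

Definition labor (i : 'I_n) : R :=
  \int[area]_(x in zone e i) density e x.

Definition productivity (i : 'I_n) : R := Abar E i * labor i `^ alpha.

Definition amenity (x : R * R) : R := bbar E x * density e x `^ beta.

Definition price (i : 'I_n) : R := wage e i / productivity i.

(* Price at j of the variety made at i. *)
Definition delivered (i j : 'I_n) : R := trade E i j * price i.

(* Also meaningful at a vacant district i: the sum only ranges over S. *)
Definition price_index (i : 'I_n) : R :=
  (\sum_(j in S) delivered j i `^ (1 - sigma)) `^ (1 / (1 - sigma)).

Definition consumption (i j : 'I_n) : R :=
  delivered i j `^ (- sigma) * price_index j `^ (sigma - 1) * wage e j.

Definition indirect_utility (x : R * R) (i : 'I_n) : R :=
  amenity x * wage e i / (commuting E x i * price_index i).

Record centric_equilibrium (Ltot : R) : Prop := CentricEquilibrium {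
  wage_gt0 : forall i, i \in S -> 0 < wage e i;
  density_gt0 : forall x, city E x -> 0 < density e x;
  density_integrable : integrable area (city E) (EFin \o density e);
  zone_gt0 : forall i, i \in S -> (0 < area (zone e i))%E;
  welfare_gt0 : 0 < welfare e;
  market_clearing : forall i, i \in S ->
    productivity i * labor i =
      \sum_(j in S) trade E i j * consumption i j * labor j;
  zone_def : forall i, i \in S ->
    zone e i = [set x | city E x /\
                        forall j, j \in S -> j != i ->
                          indirect_utility x j < indirect_utility x i];
  welfare_equal : forall i x, i \in S -> zone e i x ->
    indirect_utility x i = welfare e;
  welfare_max :
    (forall x i, city E x -> i \in S -> indirect_utility x i <= welfare e) /\
    (exists x i, [/\ city E x, i \in S & indirect_utility x i = welfare e]);
  labor_total : \sum_(i in S) labor i = Ltot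
}.

Definition weight (i : 'I_n) : R :=
  delta^-1 * ln (wage e i / price_index i).

Definition cell (lambda : 'I_n -> R) (i : 'I_n) : set (R * R) :=
  [set x | city E x /\
           forall j, j \in S -> j != i ->
             dist E i x - lambda i < dist E j x - lambda j].

Definition Bint (lambda : 'I_n -> R) (i : 'I_n) : R :=
  (\int[area]_(x in cell lambda i) (bbar E x / commuting E x i) `^ (- beta^-1))
    `^ (- beta).

(* The deviators, of mass Lp, come from the active district i. *)
Definition labor_minus (i : 'I_n) (Lp : R) (j : 'I_n) : R :=
  if j == i then labor i - Lp else labor j.

Definition deviation_wage_eq (i p : 'I_n) (Lp w : R) : Prop :=
  w `^ sigma * Lp `^ (1 - alpha * (sigma - 1)) =
    \sum_(j in S) trade E p j `^ (1 - sigma) * Abar E p `^ (sigma - 1)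
                  * price_index j `^ (sigma - 1) * wage e j
                  * labor_minus i Lp j
    + Abar E p `^ (sigma - 1) * price_index p `^ (sigma - 1) * w * Lp.

(* [xget] selects the positive solution, which exists and is unique for small
   Lp > 0 (the default value 0 is then irrelevant). *)
Definition deviation_wage (i p : 'I_n) (Lp : R) : R :=
  xget 0 [set w | 0 < w /\ deviation_wage_eq i p Lp w].

Definition potential_weight (i p : 'I_n) : \bar R :=
  lim ((delta^-1 * ln (deviation_wage i p Lp / price_index p))%:E
        @[Lp --> 0^'+]).

Definition sustainable : Prop :=
  forall p i : 'I_n, p \notin S -> i \in S -> cell weight i (site E p) ->
    (potential_weight i p < (weight i - dist E i (site E p))%:E)%E.

Definition spatial_equilibrium (Ltot : R) : Prop :=
  centric_equilibrium Ltot /\ sustainable.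

End Equilibrium.

(* Main.v *)
Require Import Defs.
From HB Require Import structures.
From mathcomp Require Import all_boot all_order all_algebra.
From mathcomp Require Import all_classical all_reals all_analysis.
From mathcomp Require Import measurable_realfun.
From mathcomp Require Import ring lra.

Set Implicit Arguments.
Unset Strict Implicit.
Unset Printing Implicit Defensive.

Import Order.TTheory GRing.Theory Num.Theory.
Import numFieldNormedType.Exports.

Local Open Scope classical_set_scope.
Local Open Scope ring_scope.

(* At an equilibrium, market clearing and symmetry of trade costs make the
   ratio of revenue weighted by [P^(sigma-1)] to [p^(1-sigma)] harmonic for a
   finite Markov chain with positive transitions, hence equal to a constant
   kappa on the active districts.  The demand met by a vacant district [q]
   is then [Abar q^(sigma-1) kappa P_q^(1-sigma)].  For a small deviation of
   mass x the wage w solves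
   [w^sigma x^(1-alpha(sigma-1)) = demand + O(x) (1 + w)], so its logarithm
   tends to -oo, +oo or [ln (demand) / sigma] according to the sign of
   [1 - alpha (sigma-1)], which gives (a) and (b); in the critical case,
   expressing [p^(1-sigma)] through weights and [Bint] gives (c). *)

(** * Measure theory on the plane *)

Section Plane.
Context {R : realType}.

(** Every point of [U] lies in a rational box contained in [U], and there are countably many such
    boxes. The union runs over all quadruples of rationals; a box not contained in [U] is replaced
    by the empty set. *)
Lemma open_measurable_plane (U : set (R * R)) : open U -> measurable U.
Proof.
move=> oU.
pose box (q : (rat * rat) * (rat * rat)) : set (R * R) :=
  `]ratr q.1.1, ratr q.1.2[%classic `*` `]ratr q.2.1, ratr q.2.2[%classic.
have -> : U = \bigcup_q (if `[< box q `<=` U >] then box q else set0).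
  apply/seteqP; split => [[x y] Uxy|z [q _]]; last first.
    by case: ifP => // /asboolP; apply.
  have /nbhs_ballP[r /= r0 rU] : nbhs (x, y) U by exact: open_nbhs_nbhs.
  have near_rat (t : R) : exists q : rat * rat,
      (t \in `]ratr q.1, ratr q.2[) /\
      `]ratr q.1, ratr q.2[%classic `<=` ball t r.
    have /rat_in_itvoo[a] : t - r < t by lra.
    rewrite in_itv/= => /andP[ra at_].
    have /rat_in_itvoo[b] : t < t + r by lra.
    rewrite in_itv/= => /andP[tb br].
    exists (a, b); split => [|s /=]; first by rewrite in_itv/= at_ tb.
    rewrite in_itv/= /ball/= => /andP[as_ sb].
    by rewrite ltr_norml; apply/andP; split; lra.
  have [p [xp pU]] := near_rat x; have [q [yq qU]] := near_rat y.
  exists (p, q) => //; rewrite ifT; first by split.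
  apply/asboolP => -[s t] [/= ps qt]; apply: rU; split => /=.
    exact: pU.
  exact: qU.
apply: countable_bigcupT_measurable => [|q]; first exact: countableP.
by case: ifP => // _; exact: measurableX.
Qed.

(** If the integral vanished, [f] would be zero almost everywhere on [D]; as [f] is positive there,
    [D] would lie inside a null set. *)
Lemma Rintegral_gt0 d (T : measurableType d) (mu : {measure set T -> \bar R})
    (D : set T) (f : T -> R) :
  measurable D -> (0 < mu D)%E -> (forall x, D x -> 0 < f x) ->
  mu.-integrable D (EFin \o f) -> 0 < \int[mu]_(x in D) f x.
Proof.
move=> mD D0 f0 fint.
have int_ge0 : (0 <= \int[mu]_(x in D) (EFin \o f) x)%E.
  by apply: integral_ge0 => x Dx; rewrite lee_fin ltW// f0.
have int_fin := integrable_fin_num mD fint.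
rewrite /Rintegral fine_gt0//.
apply/andP; split; last by move: int_fin; rewrite fin_numElt => /andP[].
rewrite lt_neqAle int_ge0 andbT; apply/eqP => int0.
have : ae_eq mu D (EFin \o f) (cst 0%E).
  apply/ae_eq_integral_abs => //; first exact: (measurable_int _ fint).
  rewrite [RHS]int0; apply: eq_integral => x; rewrite inE => Dx /=.
  by rewrite ger0_norm// ltW// f0.
move=> [N [mN N0 DN]].
have DsubN : D `<=` N.
  move=> x Dx; apply: DN => /= /(_ Dx) [fx0].
  by have := f0 x Dx; rewrite fx0 ltxx.
have : (mu D <= mu N)%E by apply: le_measure => //; rewrite inE.
by rewrite N0 leNgt D0.
Qed.

End Plane.

Section AreaMeasure.
Context {R : realType}.

(* [area] is a measure for the displays of [measurableTypeR R], but
   [centric_equilibrium] states integrability for the default display of [R]: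
   the measurable sets are the same, the types of measures are not. *)
Local Notation plane := (measurableTypeR R * measurableTypeR R)%type.

Definition area_measure : {measure set plane -> \bar R} :=
  (@lebesgue_measure R \x @lebesgue_measure R)%E.

Lemma integrable_area_measure (D : set (R * R)) (f : R * R -> R) :
  measurable D -> integrable area D (EFin \o f) ->
  integrable area_measure D (EFin \o f).
Proof.
rewrite !integrable.unlock => mD /asboolP[mf foo]; apply/asboolP; split.
  exact: mf.
(* The identity is a measurable map between the two displays, so the integral of the absolute value
   can be transported along it as a pushforward. *)
pose phi : plane -> R * R := id.
have mphi : measurable_fun setT phi by move=> _ A mA; rewrite setTI; exact: mA.
apply: le_lt_trans foo; rewrite le_eqVlt; apply/orP; left; apply/eqP/esym.
apply: (@ge0_integral_pushforward _ _ plane (R * R)%type R phi mphi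
          area_measure D (abse \o (EFin \o f))) => //.
  exact: measurableT_comp mf.
by move=> y _; exact: abse_ge0.
Qed.

End AreaMeasure.

(** * The wage equation at a fixed deviating mass *)

(** Intermediate value theorem in the variable [t = ln w], where both sides become exponentials. *)
Lemma power_equation_solvable (R : realType) (sigma a b K : R) :
  1 < sigma -> 0 < a -> 0 <= b -> 0 < K ->
  exists2 w, 0 < w & w `^ sigma * a = K + b * w.
Proof.
move=> sigma1 a0 b0 K0.
pose h t := a * expR (sigma * t) - K - b * expR t.
have h_cont : continuous h.
  move=> t; apply: cvgB; last first.
    by apply: cvgM; [exact: cvg_cst|exact: continuous_expR].
  apply: cvgB; last exact: cvg_cst.
  apply: cvgM; first exact: cvg_cst.
  apply: continuous_comp; last exact: continuous_expR.
  by apply: cvgM; [exact: cvg_cst|exact: cvg_id].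
(* At [lo] the term [a * expR (sigma * lo)] is at most [K]. At [up] the factor
   [a * expR ((sigma - 1) * up)] is at least [K + b], and multiplying by [expR up >= 1] dominates
   [K + b * expR up]. The bounds by 0 give [lo <= up] and [expR up >= 1]. *)
pose lo := Num.min 0 (ln (K / a) / sigma).
pose up := Num.max 0 (ln ((K + b) / a) / (sigma - 1)).
have sigma0 : 0 < sigma by rewrite (lt_trans _ sigma1).
have s10 : 0 < sigma - 1 by rewrite subr_gt0.
have hlo : h lo <= 0.
  have : expR (sigma * lo) <= K / a.
    rewrite -[leRHS]lnK ?posrE ?divr_gt0// ler_expR mulrC -ler_pdivlMr//.
    by rewrite /lo ge_min lexx orbT.
  rewrite ler_pdivlMr// mulrC => lo_le.
  have := mulr_ge0 b0 (expR_ge0 lo); rewrite /h; lra.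
have hup : 0 <= h up.
  have up0 : 1 <= expR up by rewrite -expR0 ler_expR /up le_max lexx.
  have : (K + b) / a <= expR ((sigma - 1) * up).
    rewrite -[leLHS]lnK ?posrE ?divr_gt0 ?ltr_wpDr// ler_expR.
    by rewrite [leRHS]mulrC -ler_pdivrMr// /up le_max lexx orbT.
  rewrite ler_pdivrMr// => up_ge.
  have eup : expR (sigma * up) = expR ((sigma - 1) * up) * expR up.
    by rewrite -expRD; congr expR; ring.
  have : (K + b) * expR up <= expR ((sigma - 1) * up) * a * expR up.
    by rewrite ler_wpM2r ?expR_ge0.
  have : K <= K * expR up by rewrite ler_peMr// ltW.
  rewrite /h eup; lra.
have lo_up : lo <= up.
  by rewrite /lo /up (@le_trans _ _ 0)// ?ge_min ?le_max lexx.
have [|t _ ht] := @IVT _ h lo up 0 lo_up (continuous_subspaceT h_cont).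
  by apply/andP; split; rewrite ?ge_min ?le_max ?hlo ?hup ?orbT.
exists (expR t); first exact: expR_gt0.
by rewrite -expRM mulrC [_ * sigma]mulrC; move: ht; rewrite /h; lra.
Qed.

(* [w |-> a w^(sigma-1) - K/w] is strictly increasing on the positive axis. *)
Lemma power_equation_lt (R : realType) (sigma a b K w M : R) :
  1 < sigma -> 0 < a -> 0 < K -> 0 < w -> 0 < M -> w `^ sigma * a = K + b * w ->
  (M < w) = (M `^ sigma * a < K + b * M).
Proof.
move=> sigma1 a0 K0.
have powE x : 0 < x -> x `^ sigma = x * x `^ (sigma - 1).
  by move=> x0; rewrite mulr_powRB1//; [exact: ltW|exact: lt_trans sigma1].
have incr x y : 0 < x -> x <= y -> 0 < y ->
    x `^ (sigma - 1) <= y `^ (sigma - 1).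
  move=> x0 xy y0; apply: ge0_ler_powR => //; first by rewrite subr_ge0 ltW.
    by rewrite nnegrE ltW.
  by rewrite nnegrE ltW.
move=> w0 M0; rewrite (powE w w0) (powE M M0) => weq.
have [Mw|wM] := ltP M w.
  have := incr _ _ M0 (ltW Mw) w0.
  move: (M `^ _) (w `^ _) weq => m v weq mv; apply/esym.
  have step : M * w * m * a <= M * w * v * a
    by rewrite ler_pM2r// ler_pM2l// mulr_gt0.
  have KM : K * M < K * w by rewrite ltr_pM2l.
  (* The equation times [M] is compared with the claim times [w]: the terms in [b] coincide, and
     only [K * M < K * w] and [m <= v] remain. *)
  have : M * (w * v * a) = M * (K + b * w) by rewrite weq.
  by move=> eq; rewrite -(ltr_pM2r w0); lra.
have := incr _ _ w0 wM M0.
move: (M `^ _) (w `^ _) weq => m v weq mv; apply/esym/negbTE; rewrite -leNgt.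
have step : M * w * v * a <= M * w * m * a
    by rewrite ler_pM2r// ler_pM2l// mulr_gt0.
have KM : K * w <= K * M by rewrite ler_pM2l.
have : M * (w * v * a) = M * (K + b * w) by rewrite weq.
by move=> eq; rewrite -(ler_pM2r w0); lra.
Qed.

(** * Limit of the log wage as the deviating mass tends to zero *)

Section SmallDeviation.
Context {R : realType}.
Variables (sigma eps K0 k c delta P : R) (W : R -> R).
Hypotheses (sigma1 : 1 < sigma) (K00 : 0 < K0).
Hypotheses (delta0 : 0 < delta) (P0 : 0 < P).
(** The equation is granted only where [K0 - k * x] is positive, which is what the existence of a
    wage requires; [rhs_cvg] supplies this positivity near 0. *)
Hypothesis W_eq : \forall x \near 0^'+, 0 < K0 - k * x -> 0 < W x /\
  W x `^ sigma * x `^ eps = K0 - k * x + c * x * W x.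

Let rhs_cvg M : K0 - k * x + c * x * M @[x --> 0^'+] --> K0.
Proof.
have -> : nbhs K0 = nbhs (K0 - k * 0 + c * 0 * M) by congr nbhs; ring.
apply: cvg_at_right_filter; apply: cvgD.
  apply: cvgB; [exact: cvg_cst|apply: cvgM; [exact: cvg_cst|exact: cvg_id]].
apply: cvgM; last exact: cvg_cst.
by apply: cvgM; [exact: cvg_cst|exact: cvg_id].
Qed.

(** This trades the implicit [W x] for two explicit functions of [x]: a bound on the wage can be
    read off by testing the equation at the constant [M]. *)
Let W_lt M : 0 < M -> \forall x \near 0^'+, 0 < W x /\
  (M < W x) = (M `^ sigma * x `^ eps < K0 - k * x + c * x * M).
Proof.
move=> M0; near=> x.
have x0 : 0 < x by near: x; exact: nbhs_right_gt.
have Kx : 0 < K0 - k * x.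
  have : `|K0 - (K0 - k * x + c * x * 0)| < K0.
    by near: x; have /cvgrPdist_lt := rhs_cvg 0; apply.
  by rewrite ltr_norml => /andP[]; lra.
have [Wx0 Wxe] : 0 < W x /\
    W x `^ sigma * x `^ eps = K0 - k * x + c * x * W x.
  by move: Kx; near: x; exact: W_eq.
split=> //; apply: power_equation_lt => //; exact: powR_gt0.
Unshelve. all: by end_near. Qed.

Let log_lt y w : 0 < w ->
  (y < delta^-1 * ln (w / P)) = (P * expR (delta * y) < w).
Proof.
move=> w0; rewrite -[in LHS](ltr_pM2l delta0) mulVKf ?gt_eqF//.
by rewrite -[in LHS]ltr_expR lnK ?posrE ?divr_gt0// ltr_pdivlMr// mulrC.
Qed.

Let log_gt_near y :
  (\forall x \near 0^'+, (P * expR (delta * y)) `^ sigma * x `^ eps <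
     K0 - k * x + c * x * (P * expR (delta * y))) ->
  \forall x \near 0^'+, y < delta^-1 * ln (W x / P).
Proof.
have M0 : 0 < P * expR (delta * y) by rewrite mulr_gt0// expR_gt0.
by apply: filterS2 (W_lt M0) => x [Wx0 Wlt]; rewrite log_lt// Wlt.
Qed.

Let log_le_near y :
  (\forall x \near 0^'+, K0 - k * x + c * x * (P * expR (delta * y)) <
     (P * expR (delta * y)) `^ sigma * x `^ eps) ->
  \forall x \near 0^'+, delta^-1 * ln (W x / P) <= y.
Proof.
have M0 : 0 < P * expR (delta * y) by rewrite mulr_gt0// expR_gt0.
apply: filterS2 (W_lt M0) => x [Wx0 Wlt]; rewrite leNgt log_lt// Wlt.
by rewrite -leNgt => /ltW.
Qed.

Lemma log_wage_cvgNy : eps < 0 ->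
  (delta^-1 * ln (W x / P))%:E @[x --> 0^'+] --> -oo%E.
Proof.
move=> eps0; apply/cvgeNyPle => y.
suff : \forall x \near 0^'+, delta^-1 * ln (W x / P) <= y.
  by apply: filterS => x; rewrite lee_fin.
apply: log_le_near; set M := P * _.
have M0 : 0 < M `^ sigma by rewrite powR_gt0// mulr_gt0// expR_gt0.
have K1 : 0 < K0 + 1 by rewrite addr_gt0.
near=> x.
have x0 : 0 < x by near: x; exact: nbhs_right_gt.
have : `|K0 - (K0 - k * x + c * x * M)| < 1.
  by near: x; have /cvgrPdist_lt := rhs_cvg M; apply; rewrite ltr01.
rewrite ltr_norml => /andP[rhs_lt _].
(* Taking inverses, this bound says that [M]^ sigma * x [^ eps] exceeds [K0 + 1]. *)
have : `|0 - x `^ (- eps)| < M `^ sigma / (K0 + 1).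
  near: x; have Neps0 : 0 < - eps by rewrite oppr_gt0.
  by have /cvgrPdist_lt := powR_cvg0 Neps0; apply; rewrite divr_gt0.
rewrite sub0r normrN powRN ger0_norm ?invr_ge0 ?powR_ge0//.
rewrite -[ltRHS]invf_div ltf_pV2 ?posrE ?divr_gt0 ?(powR_gt0 _ x0)//.
rewrite ltr_pdivrMr// mulrC => ?; lra.
Unshelve. all: by end_near. Qed.

(** Now [M]^ sigma * x [^ eps] tends to 0 while the right-hand side stays above [K0 / 2], so the
    wage eventually exceeds every level. *)
Lemma log_wage_cvgy : 0 < eps ->
  (delta^-1 * ln (W x / P))%:E @[x --> 0^'+] --> +oo%E.
Proof.
move=> eps0; apply/cvgeyPgt => y.
suff : \forall x \near 0^'+, y < delta^-1 * ln (W x / P).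
  by apply: filterS => x; rewrite lte_fin.
apply: log_gt_near; set M := P * _.
have M0 : 0 < M `^ sigma by rewrite powR_gt0// mulr_gt0// expR_gt0.
have K2 : 0 < K0 / 2 by rewrite divr_gt0.
near=> x.
have : `|K0 - (K0 - k * x + c * x * M)| < K0 / 2.
  by near: x; have /cvgrPdist_lt := rhs_cvg M; apply.
rewrite ltr_norml => /andP[_ rhs_gt].
have : `|0 - x `^ eps| < K0 / 2 / M `^ sigma.
  by near: x; have /cvgrPdist_lt := powR_cvg0 eps0; apply; rewrite divr_gt0.
rewrite sub0r normrN ger0_norm ?powR_ge0// ltr_pdivlMr// mulrC => ?; lra.
Unshelve. all: by end_near. Qed.

Lemma log_wage_cvg : eps = 0 ->
  (delta^-1 * ln (W x / P))%:E @[x --> 0^'+] -->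
    (delta^-1 * ln (K0 `^ sigma^-1 / P))%:E.
Proof.
move=> eps0; apply: cvg_EFin; first exact: nearW.
have sigma0 : 0 < sigma by apply: lt_trans sigma1.
set l := (X in _ --> X).
(* Measured from the candidate limit [l], the left-hand side at the test wage is [K0] times an
   exponential of [y - l]. As the right-hand side tends to [K0], the sign of [y - l] decides the
   comparison. *)
have PlE y : (P * expR (delta * y)) `^ sigma =
    K0 * expR (sigma * delta * (y - l)).
  rewrite powRM ?expR_ge0 ?ltW// -expRM.
  have -> : P `^ sigma = K0 * expR (- (sigma * delta * l)).
    have -> : sigma * delta * l = ln ((K0 `^ sigma^-1 / P) `^ sigma).
      by rewrite ln_powR /l mulrA mulfK ?gt_eqF.
    rewrite expRN.
    rewrite lnK ?posrE ?powR_gt0 ?divr_gt0 ?powR_gt0//.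
    rewrite powRM ?invr_ge0 ?powR_ge0 ?ltW// -powRrM mulVf ?gt_eqF//.
    rewrite powRr1 ?ltW// -[P^-1]powR_inv1 ?ltW// -powRrM mulN1r powRN.
    have := powR_gt0 sigma P0; move: (P `^ _) => p p0.
    by field; rewrite !gt_eqF.
  by rewrite -mulrA -expRD; congr (_ * expR _); ring.
have sd0 : 0 < sigma * delta by rewrite mulr_gt0.
have lhs x y : (P * expR (delta * y)) `^ sigma * x `^ eps =
    K0 * expR (sigma * delta * (y - l)) by rewrite eps0 powRr0 mulr1 PlE.
apply/cvgrPdist_le => e e0.
have below : \forall x \near 0^'+, l - e < delta^-1 * ln (W x / P).
  apply: log_gt_near; set M := P * _.
  have Klt : K0 * expR (sigma * delta * (l - e - l)) < K0.
    by rewrite gtr_pMr// expR_lt1 pmulr_rlt0//; lra.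
  near=> x; rewrite lhs; near: x.
  by have /cvgr_gt := rhs_cvg M; apply.
have above : \forall x \near 0^'+, delta^-1 * ln (W x / P) <= l + e.
  apply: log_le_near; set M := P * _.
  have Klt : K0 < K0 * expR (sigma * delta * (l + e - l)).
    by rewrite ltr_pMr// expR_gt1 mulr_gt0//; lra.
  near=> x; rewrite lhs; near: x.
  by have /cvgr_lt := rhs_cvg M; apply.
by apply: filterS2 below above => x lo up; rewrite distrC ler_distl ltW.
Unshelve. all: by end_near. Qed.

End SmallDeviation.

(** * Linear identities between logarithms at equilibrium *)

(** Eliminating [lnP] and [lnw] from the clearing relation collects [(2 * sigma - 1) * lnp], the
    source of [st]; the relation for [lnB] then replaces [lnl] and brings in [1 / beta]. The first
    bracket of the result is the same for all districts. *)
Lemma price_log_identity (R : realFieldType) (sigma alpha beta : R)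
    (dl lnw lnP lnl lnA lnB lnV lnk lnp : R) :
  beta != 0 -> 2 * sigma - 1 != 0 ->
  lnw + lnl + (sigma - 1) * lnP = lnk + (1 - sigma) * lnp ->
  lnp = lnw - (lnA + alpha * lnl) -> dl = lnw - lnP ->
  lnB = - beta * lnl + lnV - dl ->
  let st := (sigma - 1) / (2 * sigma - 1) in
  (1 - sigma) * lnp =
  (st * ((1 + sigma * alpha) / beta * lnV - lnk))
  + (st * sigma * lnA + st * - ((1 + sigma * alpha) / beta) * lnB
     + - (beta^-1 * st * (1 + sigma * alpha + (sigma - 1) * beta) * dl)).
Proof.
move=> b0 s0 clear lnpE -> -> st; rewrite /st.
have -> : lnk = lnw + lnl + (sigma - 1) * lnP - (1 - sigma) * lnp.
  by rewrite clear; ring.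
by rewrite lnpE; field; rewrite s0 b0.
Qed.

(** The left side of the second inequality is the gap in the first one, multiplied by the positive
    number [st * sigma * delta]. *)
Lemma sustainability_log_identity (R : realFieldType)
    (sigma delta d lam lnAp lnAi lnPp lnPi lnw lnk lnD lnA lnr : R) :
  1 < sigma -> 0 < delta ->
  lnk = sigma * lnw + (sigma - 1) * (lnPi - lnAi) ->
  lam = delta^-1 * (lnw - lnPi) ->
  lnD = sigma^-1 * ((sigma - 1) * lnAp + lnk + (1 - sigma) * lnPp) - lnPp ->
  lnA = lnAp - lnAi -> lnr = (1 - sigma) * (lnPp - lnPi) ->
  let st := (sigma - 1) / (2 * sigma - 1) in
  (delta^-1 * lnD < lam - d) =
  (st * (sigma - 1) * lnA + lnr + st * sigma * delta * d < 0).
Proof.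
move=> sigma1 delta0 lnkE lamE lnDE lnAE lnrE st.
have sigma0 : 0 < sigma by lra.
have t0 : 0 < 2 * sigma - 1 by lra.
have -> : st * (sigma - 1) * lnA + lnr + st * sigma * delta * d =
    st * sigma * delta * (delta^-1 * lnD - (lam - d)).
  rewrite /st lnrE lnAE lnDE lamE lnkE; field.
  by rewrite !gt_eqF.
rewrite pmulr_rlt0 ?subr_lt0// mulr_gt0// mulr_gt0// divr_gt0// subr_gt0.
exact: sigma1.
Qed.

(** At the critical [alpha] the labor term of [(1 - sigma) * lnp] is exactly [lnl], so labor cancels
    from market clearing. *)
Lemma critical_clearing_ln (R : realFieldType)
    (sigma alpha lnw lnP lnl lnA lnk lnp : R) :
  0 < sigma - 1 -> alpha = 1 / (sigma - 1) ->
  lnw + lnl + (sigma - 1) * lnP = lnk + (1 - sigma) * lnp ->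
  lnp = lnw - (lnA + alpha * lnl) ->
  lnk = sigma * lnw + (sigma - 1) * (lnP - lnA).
Proof.
move=> s0 -> clear lnpE.
have -> : lnk = lnw + lnl + (sigma - 1) * lnP - (1 - sigma) * lnp.
  by rewrite clear; ring.
by rewrite lnpE; field; rewrite gt_eqF.
Qed.

Lemma ratio_scale (R : realFieldType) (a b c x y : R) :
  0 < c -> a = c * x -> b = c * y -> x / y = a / b.
Proof.
by move=> c0 -> ->; rewrite invfM mulrACA mulfV ?mul1r// gt_eqF.
Qed.

(* Maximum principle: [x/y] is harmonic for the Markov chain on [S] with
   transition weights [K i j * y j], and these are all positive. *)
Lemma positive_harmonic_proportional (R : realFieldType) (I : finType)
    (S : {set I}) (K : I -> I -> R) (x y : I -> R) :
  (exists i, i \in S) ->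
  (forall i j, i \in S -> j \in S -> 0 < K i j) ->
  (forall i, i \in S -> 0 < x i) -> (forall i, i \in S -> 0 < y i) ->
  (forall i, i \in S ->
    (\sum_(j in S) K i j * x j) * y i = x i * \sum_(j in S) K i j * y j) ->
  exists2 kappa, 0 < kappa & forall i, i \in S -> x i = kappa * y i.
Proof.
move=> [i1 i1S] K0 x0 y0 harm.
have [i iS imax] := arg_maxP (fun i => x i / y i) i1S.
exists (x i / y i); first by rewrite divr_gt0 ?x0 ?y0.
set kappa := x i / y i.
have term_ge0 j : j \in S -> 0 <= K i j * (kappa * y j - x j).
  move=> jS; apply: mulr_ge0; first by rewrite ltW ?K0.
  by rewrite subr_ge0 -ler_pdivrMr ?y0//; exact: imax.
(* Harmonicity at the maximizer [i] makes these nonnegative terms sum to zero, so each vanishes;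
   positivity of [K i j] then gives proportionality at [j]. *)
have sum0 : \sum_(j in S) K i j * (kappa * y j - x j) = 0.
  under eq_bigr do rewrite mulrBr mulrCA.
  rewrite sumrB -mulr_sumr /kappa mulrAC -harm// mulfK ?subrr//.
  by rewrite gt_eqF ?y0.
move=> j jS; have /eqP := psumr_eq0P term_ge0 sum0 jS.
by rewrite mulf_eq0 gt_eqF ?K0//= subr_eq0 => /eqP.
Qed.

(** * Positivity, commuting areas and weights at a centric equilibrium *)

Section Centric.
Context {R : realType} {n : nat} {E : economy R n}.
Context {sigma alpha beta delta L : R} {S : {set 'I_n}} {e : allocation R n}.
Hypotheses (hsigma : 1 < sigma) (hbeta : beta < 0) (hdelta : 0 < delta).
Hypothesis bbar_gt0 : forall x, city E x -> 0 < bbar E x.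
Hypothesis Abar_gt0 : forall i, 0 < Abar E i.
Hypothesis trade_sym : forall i j, trade E i j = trade E j i.
Hypothesis commutingE :
  forall x i, city E x -> commuting E x i = expR (delta * dist E i x).
Hypothesis S_neq0 : exists i, i \in S.
Hypothesis he : centric_equilibrium E sigma alpha beta S e L.

Local Notation w := (wage e).
Local Notation l := (labor e).
Local Notation p := (price E alpha e).
Local Notation P := (price_index E sigma alpha S e).
Local Notation lambda := (weight E sigma alpha delta S e).
Local Notation B := (Bint E beta S lambda).

Let sigma0 : 0 < sigma. Proof. exact: lt_trans hsigma. Qed.
Let trade_gt0 i j : 0 < trade E i j.
Proof. exact: lt_le_trans (trade_ge1 E i j). Qed.

Let amenity_gt0 x : city E x -> 0 < amenity E beta e x.
Proof.
by move=> cx; rewrite mulr_gt0 ?bbar_gt0// powR_gt0// (density_gt0 he).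
Qed.

(* Stated without the weights, which are only meaningful once labor is known
   to be positive. *)
Lemma indirect_utilityE x i : city E x ->
  indirect_utility E sigma alpha beta S e x i =
  amenity E beta e x * (w i / P i * expR (- (delta * dist E i x))).
Proof.
move=> cx; rewrite /indirect_utility commutingE// expRN invfM.
by rewrite -!mulrA [_^-1 * (P i)^-1]mulrC.
Qed.

(** The amenity, of which no continuity is known, is a common positive factor in all comparisons.
    Cancelling it leaves the continuous functions [u j], hence finitely many open conditions. *)
Lemma measurable_zone i : i \in S -> measurable (zone e i).
Proof.
move=> iS.
pose u j x := w j / P j * expR (- (delta * dist E j x)).
have -> : zone e i = city E `&`
    \bigcap_(j in [set j | j \in S /\ j != i]) [set x | 0 < u i x - u j x].
  rewrite (zone_def he iS); apply/seteqP; split => x /= [cx H]; split=> //.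
    move=> j [/= jS ji]; have := H j jS ji.
    by rewrite !indirect_utilityE// ltr_pM2l ?amenity_gt0// subr_gt0.
  move=> j jS ji; rewrite !indirect_utilityE// ltr_pM2l ?amenity_gt0//.
  by rewrite -subr_gt0; exact: H.
apply: measurableI; first by apply: open_measurable_plane; exact: city_open.
apply: fin_bigcap_measurable => [|j _]; first exact: finite_finset.
have u_cont k : continuous (u k).
  move=> x; apply: cvgM; first exact: cvg_cst.
  apply: continuous_comp; last exact: continuous_expR.
  by apply: cvgN; apply: cvgM; [exact: cvg_cst|exact: dist_continuous].
apply: open_measurable_plane.
apply: (@open_comp _ _ (fun x => u i x - u j x) [set y | 0 < y]).
  by move=> x _; apply: cvgB; exact: u_cont.
exact: open_gt.
Qed.

Let zone_city i : i \in S -> zone e i `<=` city E.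
Proof. by move=> iS x; rewrite (zone_def he iS) => -[]. Qed.

Lemma density_integrable_zone i : i \in S ->
  area_measure.-integrable (zone e i) (EFin \o density e).
Proof.
have mcity : measurable (city E) := open_measurable_plane (@city_open _ _ E).
move=> iS.
apply: integrableS (integrable_area_measure mcity (density_integrable he)).
- exact: mcity.
- exact: measurable_zone.
- exact: zone_city.
Qed.

Lemma labor_gt0 i : i \in S -> 0 < l i.
Proof.
move=> iS.
apply: (@Rintegral_gt0 _ _ _ area_measure) (density_integrable_zone iS).
- exact: measurable_zone.
- exact: (zone_gt0 he).
- by move=> x /(zone_city iS); exact: (density_gt0 he).
Qed.

Lemma price_gt0 i : i \in S -> 0 < p i.
Proof.
move=> iS; rewrite divr_gt0 ?(wage_gt0 he)// mulr_gt0// powR_gt0//.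
exact: labor_gt0.
Qed.

(** By symmetry, import costs into [i] become export costs from [i], the form in which demand for
    the goods of [i] is written. It also holds at vacant [i]. *)
Lemma price_indexE i :
  P i `^ (1 - sigma) =
  \sum_(j in S) trade E i j `^ (1 - sigma) * p j `^ (1 - sigma).
Proof.
rewrite -powRrM mul1r mulVf ?subr_eq0 ?lt_eqF// powRr1; last first.
  by apply: sumr_ge0 => j _; exact: powR_ge0.
apply: eq_bigr => j jS.
by rewrite /delivered powRM 1?trade_sym// ltW// price_gt0.
Qed.

Lemma price_index_gt0 i : 0 < P i.
Proof.
rewrite powR_gt0//; have [j jS] := S_neq0.
rewrite (bigD1 j)//= ltr_pwDl//.
  by rewrite powR_gt0// mulr_gt0// price_gt0.
by apply: sumr_ge0 => k _; exact: powR_ge0.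
Qed.

Lemma ratio_weight i : i \in S -> w i / P i = expR (delta * lambda i).
Proof.
move=> iS; rewrite /weight mulVKf ?gt_eqF// lnK// posrE divr_gt0//.
  exact: (wage_gt0 he).
exact: price_index_gt0.
Qed.

Lemma indirect_utility_weight x i : city E x -> i \in S ->
  indirect_utility E sigma alpha beta S e x i =
  amenity E beta e x * expR (delta * (lambda i - dist E i x)).
Proof.
by move=> cx iS; rewrite indirect_utilityE// ratio_weight// -expRD -mulrBr.
Qed.

Lemma zone_cell i : i \in S -> zone e i = cell E S lambda i.
Proof.
move=> iS.
have uP j x : j \in S -> city E x ->
    (indirect_utility E sigma alpha beta S e x j <
     indirect_utility E sigma alpha beta S e x i) =
    (dist E i x - lambda i < dist E j x - lambda j).
  move=> jS cx; rewrite !indirect_utility_weight// ltr_pM2l ?amenity_gt0//.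
  rewrite ltr_expR (ltr_pM2l hdelta).
  move: (lambda i) (lambda j) (dist E i x) (dist E j x) => a b c d.
  by apply/idP/idP => ?; lra.
rewrite (zone_def he iS); apply/seteqP; split=> x /= [cx H]; split=> // j jS ji.
  by rewrite -uP//; exact: H.
by rewrite uP//; exact: H.
Qed.

(** * Market clearing and closed forms for prices *)

(** With [x] the weighted revenue, [y = p^(1-sigma)] and [K = T^(1-sigma)], the sum of [K y] is
    [P^(1-sigma)], and clearing makes the sum of [K x] times [y] equal to [w l]; both sides of the
    harmonicity relation are then [w l]. *)
Lemma revenue_proportional : exists2 kappa, 0 < kappa &
  forall i, i \in S ->
    w i * l i * P i `^ (sigma - 1) = kappa * p i `^ (1 - sigma).
Proof.
apply: (positive_harmonic_proportional
  (K := fun i j => trade E i j `^ (1 - sigma))).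
- exact: S_neq0.
- by move=> i j _ _; exact: powR_gt0.
- move=> i iS; have P0 := price_index_gt0 i.
  do 2?apply: mulr_gt0; [|exact: labor_gt0|exact: powR_gt0].
  exact: wage_gt0 he i iS.
- by move=> i iS; apply: powR_gt0; exact: price_gt0.
move=> i iS.
have p0 := price_gt0 iS.
have A0 : 0 < productivity E alpha e i.
  by rewrite mulr_gt0// powR_gt0// labor_gt0.
have clear : productivity E alpha e i * l i =
    p i `^ (- sigma) *
    \sum_(j in S) trade E i j `^ (1 - sigma) * (w j * l j * P j `^ (sigma - 1)).
  rewrite (market_clearing he iS) mulr_sumr; apply: eq_bigr => j jS.
  rewrite /consumption /delivered (powRM _ (ltW (trade_gt0 i j)) (ltW p0)).
  have -> : trade E i j `^ (1 - sigma) = trade E i j * trade E i j `^ (- sigma).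
    rewrite powRD; last by apply/implyP => _; rewrite gt_eqF.
    by rewrite powRr1// ltW.
  move: (trade E i j) (_ `^ - sigma) (p i `^ _) (P j `^ _) (w j) (l j).
  by move=> *; ring.
have PP : P i `^ (sigma - 1) * P i `^ (1 - sigma) = 1.
  have := price_index_gt0 i; move: (P i) => q q0.
  by rewrite -(opprB sigma) powRN mulfV// gt_eqF// powR_gt0.
rewrite -price_indexE -[RHS]mulrA PP mulr1.
have -> : p i `^ (1 - sigma) = p i * p i `^ (- sigma).
  rewrite powRD; last by apply/implyP => _; rewrite gt_eqF.
  by rewrite powRr1// ltW.
rewrite mulrC -mulrA -clear mulrA; congr (_ * _).
by rewrite /price divfK// gt_eqF.
Qed.

Let Bint_labor i : i \in S ->
  0 < B i /\ ln (B i) = - beta * ln (l i) + ln (welfare e) - delta * lambda i.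
Proof.
move=> iS.
set g := fun x => (bbar E x / commuting E x i) `^ (- beta^-1).
(* Equal welfare on the zone reads [V = (bbar / D) * density^beta * expR (delta * lambda i)]. Raised
   to the power [-1/beta], it makes the integrand of [Bint] proportional to the density, with factor
   [C^-1]. *)
set C := expR (beta^-1 * (ln (welfare e) - delta * lambda i)).
have beta_neq0 : beta != 0 by rewrite lt_eqF.
have gE x : zone e i x -> g x = C^-1 * density e x.
  move=> zx; have cx := zone_city iS zx.
  have l0 := density_gt0 he cx; have b0 := bbar_gt0 cx.
  have D0 : 0 < commuting E x i by rewrite commutingE// expR_gt0.
  have q0 : 0 < bbar E x / commuting E x i by rewrite divr_gt0.
  have := welfare_equal he iS zx.
  rewrite /indirect_utility /amenity invfM.
  have -> : bbar E x * density e x `^ beta * w i *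
      ((commuting E x i)^-1 * (P i)^-1) =
      (bbar E x / commuting E x i) * density e x `^ beta * (w i / P i).
    by move: (P i) (w i) => *; ring.
  rewrite ratio_weight// => /(congr1 (@ln R)).
  have d0 : 0 < density e x `^ beta by exact: powR_gt0.
  rewrite (lnM (mulr_gt0 q0 d0) (expR_gt0 _)) (lnM q0 d0) ln_powR expRK => lnE.
  rewrite -[LHS]lnK ?posrE ?powR_gt0// -[density e x]lnK ?posrE//.
  rewrite /C -expRN -expRD; congr expR; rewrite ln_powR -lnE.
  move: (ln _) (ln _) (lambda i) => a b c.
  by field.
have intE : \int[area_measure]_(x in cell E S lambda i) g x = C^-1 * l i.
  rewrite -zone_cell// /labor.
  rewrite -[RHS](@RintegralZl _ _ _ area_measure (zone e i) (density e) C^-1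
    (measurable_zone iS) (density_integrable_zone iS)).
  by apply: eq_Rintegral => x; rewrite inE; exact: gE.
have l0 := labor_gt0 iS.
have C0 : 0 < C by exact: expR_gt0.
have -> : B i = (C^-1 * l i) `^ (- beta) by rewrite -intE.
split; first by rewrite powR_gt0// mulr_gt0// invr_gt0.
rewrite ln_powR lnM ?posrE ?invr_gt0// lnV// /C expRK.
by move: (lambda i) => ?; field.
Qed.

Let clearing_ln kappa i : 0 < kappa -> i \in S ->
  w i * l i * P i `^ (sigma - 1) = kappa * p i `^ (1 - sigma) ->
  ln (w i) + ln (l i) + (sigma - 1) * ln (P i) =
  ln kappa + (1 - sigma) * ln (p i).
Proof.
move=> kappa0 iS.
have w0 := wage_gt0 he iS; have l0 := labor_gt0 iS.
have P0 := powR_gt0 (sigma - 1) (price_index_gt0 i).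
have p0 := powR_gt0 (1 - sigma) (price_gt0 iS).
move=> /(congr1 (@ln R)).
by rewrite (lnM (mulr_gt0 w0 l0) P0) (lnM w0 l0) (lnM kappa0 p0) !ln_powR.
Qed.

Let price_ln i : i \in S ->
  ln (p i) = ln (w i) - (ln (Abar E i) + alpha * ln (l i)).
Proof.
move=> iS; have w0 := wage_gt0 he iS.
have a0 := powR_gt0 alpha (labor_gt0 iS).
rewrite (ln_div w0 (mulr_gt0 (Abar_gt0 i) a0)) (lnM (Abar_gt0 i) a0).
by rewrite ln_powR.
Qed.

Let weight_ln i : i \in S -> delta * lambda i = ln (w i) - ln (P i).
Proof.
move=> iS; rewrite /weight mulVKf ?gt_eqF//.
by rewrite (ln_div (wage_gt0 he iS) (price_index_gt0 i)).
Qed.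

Lemma price_term :
  let gamma2 := 1 + sigma * alpha + (sigma - 1) * beta in
  let sigmat := (sigma - 1) / (2 * sigma - 1) in
  let phi2 := - ((1 + sigma * alpha) / beta) in
  exists2 c, 0 < c & forall j, j \in S -> p j `^ (1 - sigma) =
    c * (Abar E j `^ (sigmat * sigma) * B j `^ (sigmat * phi2)
         * expR (- (delta / beta) * sigmat * gamma2 * lambda j)).
Proof.
move=> gamma2 sigmat phi2.
have [kappa kappa0 prop] := revenue_proportional.
(* This exponent is the bracket of [price_log_identity] that involves only [welfare e] and [kappa],
   not the district. *)
exists (expR (sigmat *
  ((1 + sigma * alpha) / beta * ln (welfare e) - ln kappa))).
  exact: expR_gt0.
move=> j jS; have [B0 lnB] := Bint_labor jS.
rewrite -[LHS]lnK ?posrE ?powR_gt0 ?price_gt0// ln_powR.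
rewrite /powR (gt_eqF (Abar_gt0 j)) (gt_eqF B0) -!expRD; congr expR.
have s0 : 2 * sigma - 1 != 0 by rewrite gt_eqF//; move: hsigma => ?; lra.
have beta0 : beta != 0 by rewrite lt_eqF.
rewrite (price_log_identity beta0 s0 (clearing_ln kappa0 jS (prop j jS))
  (price_ln jS) (weight_ln jS) lnB) /gamma2 /sigmat /phi2.
move: (lambda j) (ln _) (ln _) (ln _) => *.
by field; rewrite s0 beta0.
Qed.

(** * Demand and wage at a vacant district *)

(** As functions of the deviating mass, the sum in the wage equation has constant term [demand q]
    and slope [- gain q i]; [competition q] below is the coefficient of [w * Lp]. *)
Let gain q j :=
  trade E q j `^ (1 - sigma) * Abar E q `^ (sigma - 1)
  * P j `^ (sigma - 1) * w j.

Let demand q := \sum_(j in S) gain q j * l j.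

Let gain_gt0 q j : j \in S -> 0 < gain q j.
Proof.
move=> jS; apply: mulr_gt0; last exact: (wage_gt0 he).
apply: mulr_gt0; last by apply: powR_gt0; exact: price_index_gt0.
by apply: mulr_gt0; exact: powR_gt0.
Qed.

Let demand_gt0 q : 0 < demand q.
Proof.
have [j jS] := S_neq0; rewrite /demand (bigD1 j)//=.
apply: ltr_pwDl; first by rewrite mulr_gt0 ?gain_gt0 ?labor_gt0.
apply: sumr_ge0 => k /andP[kS _].
by rewrite ltW// mulr_gt0 ?gain_gt0 ?labor_gt0.
Qed.

Let demand_minus q i x : i \in S ->
  \sum_(j in S) gain q j * labor_minus e i x j = demand q - gain q i * x.
Proof.
move=> iS; rewrite /demand (bigD1 i)//= [in RHS](bigD1 i)//=.
rewrite {1}/labor_minus eqxx mulrBr addrAC; congr (_ + _ - _).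
by apply: eq_bigr => j /andP[_ /negbTE ji]; rewrite /labor_minus ji.
Qed.

Let competition q := Abar E q `^ (sigma - 1) * P q `^ (sigma - 1).

Let W := deviation_wage E sigma alpha S e.

(** Existence of a positive solution rules out the default value of [xget], so the selected wage
    does satisfy the equation. *)
Let deviation_wageP q i : i \in S -> \forall x \near 0^'+,
  0 < demand q - gain q i * x -> 0 < W i q x /\
  W i q x `^ sigma * x `^ (1 - alpha * (sigma - 1)) =
    demand q - gain q i * x + competition q * x * W i q x.
Proof.
move=> iS; near=> x => K0.
have x0 : 0 < x by near: x; exact: nbhs_right_gt.
have eqE v : deviation_wage_eq E sigma alpha S e i q x v <->
    v `^ sigma * x `^ (1 - alpha * (sigma - 1)) =
    demand q - gain q i * x + competition q * x * v.
  rewrite /deviation_wage_eq demand_minus// -/(competition q).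
  by rewrite mulrAC [_ * v * x]mulrAC.
have c0 : 0 <= competition q * x.
  by apply: mulr_ge0 (ltW x0); rewrite mulr_ge0 ?powR_ge0.
have [v v0 vE] := power_equation_solvable hsigma
  (powR_gt0 (1 - alpha * (sigma - 1)) x0) c0 K0.
have [W0 /eqE] : [set v | 0 < v /\
    deviation_wage_eq E sigma alpha S e i q x v] (W i q x).
  by apply: xgetPex; exists v; split=> //; apply/eqE.
by split.
Unshelve. all: by end_near. Qed.

(** * Potential weights in the three regimes *)

Local Notation potential := (potential_weight E sigma alpha delta S e).

Lemma potential_weightNy q i : i \in S -> 1 / (sigma - 1) < alpha ->
  potential i q = -oo%E.
Proof.
move=> iS; rewrite ltr_pdivrMr ?subr_gt0// => alpha_gt.
apply: cvg_lim => //.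
have eps0 : 1 - alpha * (sigma - 1) < 0 by rewrite subr_lt0.
exact: log_wage_cvgNy hsigma (demand_gt0 q) hdelta (price_index_gt0 q)
  (deviation_wageP q iS) eps0.
Qed.

Lemma potential_weighty q i : i \in S -> alpha < 1 / (sigma - 1) ->
  potential i q = +oo%E.
Proof.
move=> iS; rewrite ltr_pdivlMr ?subr_gt0// => alpha_lt.
apply: cvg_lim => //.
have eps0 : 0 < 1 - alpha * (sigma - 1) by rewrite subr_gt0.
exact: log_wage_cvgy hsigma (demand_gt0 q) hdelta (price_index_gt0 q)
  (deviation_wageP q iS) eps0.
Qed.

Lemma potential_weightE q i : i \in S -> alpha = 1 / (sigma - 1) ->
  potential i q = (delta^-1 * ln (demand q `^ sigma^-1 / P q))%:E.
Proof.
move=> iS alphaE; apply: cvg_lim => //.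
have eps0 : 1 - alpha * (sigma - 1) = 0.
  by rewrite alphaE divfK ?subrr// gt_eqF// subr_gt0.
exact: log_wage_cvg hsigma (demand_gt0 q) hdelta (price_index_gt0 q)
  (deviation_wageP q iS) eps0.
Qed.

(** Proportionality replaces each revenue by [kappa * p^(1-sigma)], and the remaining sum is the
    price index at [q]. *)
Let demandE kappa q :
  (forall j, j \in S ->
    w j * l j * P j `^ (sigma - 1) = kappa * p j `^ (1 - sigma)) ->
  demand q = Abar E q `^ (sigma - 1) * (kappa * P q `^ (1 - sigma)).
Proof.
move=> prop; rewrite price_indexE !mulr_sumr; apply: eq_bigr => j jS.
rewrite /gain; have := prop j jS.
move: (trade E q j `^ _) (Abar E q `^ _) (P j `^ _) (p j `^ _) (w j) (l j).
by move=> t a b c u v bE; rewrite [kappa * _]mulrCA -bE; ring.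
Qed.

(** The limit weight involves [kappa], which critical clearing at [i] expresses without labor. The
    ratio of sums equals that of [P^(1-sigma)] at [q] and [i], since the constant of [price_term]
    cancels. *)
Lemma sustainable_criticalP q i d : alpha = 1 / (sigma - 1) -> i \in S ->
  let gamma2 := 1 + sigma * alpha + (sigma - 1) * beta in
  let sigmat := (sigma - 1) / (2 * sigma - 1) in
  let phi2 := - ((1 + sigma * alpha) / beta) in
  let term j := Abar E j `^ (sigmat * sigma) * B j `^ (sigmat * phi2)
                * expR (- (delta / beta) * sigmat * gamma2 * lambda j) in
  (potential i q < (lambda i - d)%:E)%E =
  (sigmat * (sigma - 1) * ln (Abar E q / Abar E i)
   + ln ((\sum_(j in S) trade E q j `^ (1 - sigma) * term j)
         / (\sum_(j in S) trade E i j `^ (1 - sigma) * term j))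
   + sigmat * sigma * delta * d < 0).
Proof.
move=> alphaE iS gamma2 sigmat phi2 term.
rewrite potential_weightE// lte_fin.
have [kappa kappa0 prop] := revenue_proportional.
have [c c0 termE] := price_term.
have sumE k : P k `^ (1 - sigma) =
    c * \sum_(j in S) trade E k j `^ (1 - sigma) * term j.
  rewrite price_indexE mulr_sumr; apply: eq_bigr => j jS.
  by rewrite termE// mulrCA.
have ratioE : (\sum_(j in S) trade E q j `^ (1 - sigma) * term j)
         / (\sum_(j in S) trade E i j `^ (1 - sigma) * term j) =
    P q `^ (1 - sigma) / P i `^ (1 - sigma).
  exact: (ratio_scale c0 (sumE q) (sumE i)).
have Pq := price_index_gt0 q; have Pi := price_index_gt0 i.
have s10 : 0 < sigma - 1 by rewrite subr_gt0.
have lnk : ln kappa =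
    sigma * ln (w i) + (sigma - 1) * (ln (P i) - ln (Abar E i)).
  exact: critical_clearing_ln s10 alphaE (clearing_ln kappa0 iS (prop i iS))
    (price_ln iS).
have weightE : lambda i = delta^-1 * (ln (w i) - ln (P i)).
  by rewrite -weight_ln// mulKf// gt_eqF.
have demand_ln : ln (demand q `^ sigma^-1 / P q) =
    sigma^-1 * ((sigma - 1) * ln (Abar E q) + ln kappa + (1 - sigma) * ln (P q))
    - ln (P q).
  rewrite (ln_div (powR_gt0 _ (demand_gt0 q)) Pq) ln_powR (demandE q prop).
  have kP := mulr_gt0 kappa0 (powR_gt0 (1 - sigma) Pq).
  rewrite (lnM (powR_gt0 _ (Abar_gt0 q)) kP) (lnM kappa0 (powR_gt0 _ Pq)).
  by rewrite !ln_powR addrA.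
have ratio_ln : ln ((\sum_(j in S) trade E q j `^ (1 - sigma) * term j)
         / (\sum_(j in S) trade E i j `^ (1 - sigma) * term j)) =
    (1 - sigma) * (ln (P q) - ln (P i)).
  rewrite ratioE (ln_div (powR_gt0 _ Pq) (powR_gt0 _ Pi)) mulrBr.
  by congr (_ - _); exact: ln_powR.
exact: (sustainability_log_identity d hsigma hdelta lnk weightE demand_ln
  (ln_div (Abar_gt0 q) (Abar_gt0 i)) ratio_ln).
Qed.

End Centric.

Theorem corollary1 (R : realType) (n : nat) (E : economy R n)
    (sigma alpha beta delta L : R)
    (hn : (2 <= n)%N)
    (hsigma : 1 < sigma) (halpha : -1 < alpha) (hbeta : beta < 0)
    (hdelta : 0 < delta) (hL : 0 < L)
    (h_b : exists bmin bmax : R,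
       0 < bmin /\ forall x, city E x -> bmin <= bbar E x <= bmax)
    (h_A : exists Amin Amax : R,
       0 < Amin /\ forall i, Amin <= Abar E i <= Amax)
    (h_Tsym : forall i j, trade E i j = trade E j i)
    (h_T : exists Tmax : R, forall i j, 1 <= trade E i j <= Tmax)
    (h_D : forall x i, city E x -> commuting E x i = expR (delta * dist E i x))
    (h_adm : admissible (dist E))
    (h_tri : forall i j x, city E x ->
       dist E i x <= dist E i (site E j) + dist E j x)
    (h_loc : exists r c C : R, [/\ 0 < r, 0 < c, 0 < C &
       forall i x, euclid x (site E i) < r ->
         c * euclid x (site E i) <= dist E i x <= C * euclid x (site E i)])
    (S : {set 'I_n}) (hS : exists i, i \in S)
    (e : allocation R n)
    (he : centric_equilibrium E sigma alpha beta S e L) :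
  let lambda := weight E sigma alpha delta S e in
  let gamma2 := 1 + sigma * alpha + (sigma - 1) * beta in
  let sigmat := (sigma - 1) / (2 * sigma - 1) in
  let phi2 := - ((1 + sigma * alpha) / beta) in
  let term j := Abar E j `^ (sigmat * sigma)
                * Bint E beta S lambda j `^ (sigmat * phi2)
                * expR (- (delta / beta) * sigmat * gamma2 * lambda j) in
  [/\ (* (a) *)
      1 / (sigma - 1) < alpha ->
        spatial_equilibrium E sigma alpha beta delta S e L,
      (* (b) *)
      alpha < 1 / (sigma - 1) ->
        S != [set: 'I_n]%SET ->
        (forall p, p \notin S ->
           exists2 i, i \in S & cell E S lambda i (site E p)) ->
        ~ spatial_equilibrium E sigma alpha beta delta S e L &
      (* (c) *)
      alpha = 1 / (sigma - 1) ->
        (spatial_equilibrium E sigma alpha beta delta S e L <->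
         forall p i, p \notin S -> i \in S -> cell E S lambda i (site E p) ->
           sigmat * (sigma - 1) * ln (Abar E p / Abar E i)
           + ln ((\sum_(j in S) trade E p j `^ (1 - sigma) * term j)
                 / (\sum_(j in S) trade E i j `^ (1 - sigma) * term j))
           + sigmat * sigma * delta * dist E i (site E p) < 0)].
Proof.
move=> lambda gamma2 sigmat phi2 term.
have bbar_gt0 x : city E x -> 0 < bbar E x.
  by have [bmin [bmax [b0 bE]]] := h_b; move=> /bE /andP[/(lt_le_trans b0)].
have Abar_gt0 i : 0 < Abar E i.
  have [Amin [Amax [A0 AE]]] := h_A.
  by have /andP[/(lt_le_trans A0)] := AE i.
split.
- move=> alpha_gt; split=> // p i pS iS _.
  rewrite (potential_weightNy hsigma hdelta bbar_gt0 Abar_gt0 h_D hS he)//.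
  exact: ltNyr.
- move=> alpha_lt Sneq coverS [_ sust].
  have [p pS] : exists p, p \notin S.
    apply/existsP; apply: contraNT Sneq; rewrite negb_exists => /forallP allS.
    by apply/eqP/setP => p; rewrite inE; have := allS p; rewrite negbK => ->.
  (* In the cell given by [coverS], sustainability would place [+oo] below a real number. *)
  have [i iS cellp] := coverS p pS; have := sust p i pS iS cellp.
  by rewrite (potential_weighty hsigma hdelta bbar_gt0 Abar_gt0 h_D hS he).
- move=> alphaE.
  have criticalP q i d : i \in S ->
      (potential_weight E sigma alpha delta S e i q < (lambda i - d)%:E)%E =
      (sigmat * (sigma - 1) * ln (Abar E q / Abar E i)
       + ln ((\sum_(j in S) trade E q j `^ (1 - sigma) * term j)
             / (\sum_(j in S) trade E i j `^ (1 - sigma) * term j))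
       + sigmat * sigma * delta * d < 0).
    move=> iS; exact: (sustainable_criticalP hsigma hbeta hdelta bbar_gt0
      Abar_gt0 h_Tsym h_D hS he q d alphaE iS).
  split=> [[_ sust] p i pS iS cellp|cond].
    by have := sust p i pS iS cellp; rewrite criticalP.
  split=> // p i pS iS cellp.
  by have := cond p i pS iS cellp; rewrite -criticalP.
Qed.
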